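(* For every integer $p\ge1$, the set $\langle a,P(a,p)+1\rangle$ is the singleton whose only element is $\max\langle b,p\rangle$; that is, $\{\max\langle K_0,p\rangle\}=\{\max\langle b,p\rangle\}=\langle a,P(a,p)+1\rangle$.
   Context: The Fibonacci sequence $\mathbb{F}$ is the infinite word over $\{a,b\}$ that is the fixed point beginning with $a$ of the morphism $\sigma(a)=ab$, $\sigma(b)=a$; positions are numbered from $1$. Put $F_{-1}=b$ and $F_m=\sigma^m(a)$ for $m\ge0$, and let $\delta_m$ be the last letter of $F_m$ ($m\ge-1$). The $m$-th kernel word ($m\ge-1$) is $K_m=\delta_{m+1}F_m\delta_m^{-1}$, i.e. delete the last letter of $F_m$ and put the letter $\delta_{m+1}$ in front; thus $K_{-1}=a$, $K_0=b$, $K_1=aa$, $K_2=bab$, and so on. For a nonempty factor $\omega$ of $\mathbb{F}$, $Ker(\omega)$ is the maximal kernel word occurring in $\omega$, i.e. the $K_m$ of largest index $m$ that is a factor of $\omega$. For a factor $\omega$ and $p\ge1$, $P(\omega,p)$ is the position of the last letter of the $p$-th occurrence of $\omega$ in $\mathbb{F}$. $\mathcal{P}_F$ is the set of nonempty palindromes occurring as factors of $\mathbb{F}$. For $m\ge-1$, $p\ge1$, $\langle K_m,p\rangle=\{P(\omega,p):\omega\in\mathcal{P}_F,\ Ker(\omega)=K_m\}$; in particular $\langle a,p\rangle=\langle K_{-1},p\rangle$ and $\langle b,p\rangle=\langle K_0,p\rangle$. *)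

(* Defs.v *)
From HB Require Import structures.
From mathcomp Require Import all_boot all_order.
From mathcomp Require Import boolp classical_sets.

Set Implicit Arguments.
Unset Strict Implicit.
Unset Printing Implicit Defensive.

Local Open Scope nat_scope.

Inductive letter := a | b.

Definition letter_eqb (x y : letter) : bool :=
  match x, y with a, a | b, b => true | _, _ => false end.

Lemma letter_eqP : Equality.axiom letter_eqb.
Proof. by do 2 case; constructor. Qed.

HB.instance Definition _ := hasDecEq.Build letter letter_eqP.

Notation word := (seq letter).

Definition sigma_letter (x : letter) : word :=
  match x with a => [:: a; b] | b => [:: a] end.

Definition sigma (w : word) : word := flatten (map sigma_letter w).

(* Indices are shifted by one, since the words F_m, K_m and the letters
   delta_m start at m = -1: [Fword k] is F_{k-1}, [delta k] is delta_{k-1}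
   and [kernel k] is K_{k-1}. *)
Definition Fword (k : nat) : word :=
  if k is m.+1 then iter m sigma [:: a] else [:: b].

Definition delta (k : nat) : letter := last a (Fword k).

Definition kernel (k : nat) : word :=
  delta k.+1 :: take (size (Fword k)).-1 (Fword k).

(* The letter of the Fibonacci sequence at position n.+1. The words sigma^n(a)
   are prefixes of one another and sigma^n(a) has more than n letters.
   [fib_fixpoint] and [fib_unique] below show that this is the fixed point of
   sigma beginning with a. *)
Definition fib (n : nat) : letter := nth a (iter n sigma [:: a]) n.

Definition pref (x : nat -> letter) (n : nat) : word := mkseq x n.

Definition fixed_by_sigma (x : nat -> letter) : Prop :=
  forall n, sigma (pref x n) = pref x (size (sigma (pref x n))).

Definition factor (w : word) : Prop := exists n, infix w (pref fib n).

(* w occurs in the Fibonacci sequence with its last letter at position n,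
   positions being numbered from 1. *)
Definition occurs_at (w : word) (n : nat) : bool := suffix w (pref fib n).

Definition is_occurrence (w : word) (p n : nat) : Prop :=
  occurs_at w n /\ count (occurs_at w) (iota 1 n) = p.

(* For a nonempty factor w and p >= 1, the p-th occurrence exists and is unique:
   see [P_spec]. *)
Definition P (w : word) (p : nat) : nat :=
  xget 0 [set n | is_occurrence w p n]%classic.

(* A kernel word [kernel k] has at least k letters, so the bound on k loses
   nothing: see [kernel_le_Ker_index] and [Ker_infix]. *)
Definition Ker_index (w : word) : nat :=
  \max_(k < (size w).+1 | infix (kernel k) w) k.

Definition Ker (w : word) : word := kernel (Ker_index w).

Definition pal_factors : set word :=
  [set w | [/\ w <> [::], rev w = w & factor w]]%classic.

(* The set <K, p>, for a kernel word K. *)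
Definition bracket (K : word) (p : nat) : set nat :=
  [set P w p | w in [set w | pal_factors w /\ Ker w = K]]%classic.

Definition is_max (A : set nat) (n : nat) : Prop := A n /\ ubound A n.

Lemma sigma_cat u v : sigma (u ++ v) = sigma u ++ sigma v.
Proof. by rewrite /sigma map_cat flatten_cat. Qed.

Lemma iter_sigmaSS n :
  iter n.+2 sigma [:: a] = iter n.+1 sigma [:: a] ++ iter n sigma [:: a].
Proof. by elim: n => [//|n IH]; rewrite iterS [in LHS]IH sigma_cat. Qed.

Lemma iter_sigma_prefixS n :
  prefix (iter n sigma [:: a]) (iter n.+1 sigma [:: a]).
Proof. by case: n => [//|n]; rewrite iter_sigmaSS prefix_prefix. Qed.

Lemma iter_sigma_prefix m n :
  m <= n -> prefix (iter m sigma [:: a]) (iter n sigma [:: a]).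
Proof.
move=> /subnK <-; elim: (n - m) => [|k IH]; first exact: prefix_refl.
by rewrite addSn; apply: prefix_trans IH (iter_sigma_prefixS _).
Qed.

Lemma size_iter_sigma n : n < size (iter n sigma [:: a]).
Proof.
suff: n < size (iter n sigma [:: a]) /\ n.+1 < size (iter n.+1 sigma [:: a]).
  by case.
elim: n => [//|n [IH1 IH2]]; split=> //.
rewrite iter_sigmaSS size_cat -addn1; apply: (leq_add IH2).
exact: leq_ltn_trans IH1.
Qed.

Lemma fibE m i : i < size (iter m sigma [:: a]) ->
  fib i = nth a (iter m sigma [:: a]) i.
Proof.
move=> lt_i; rewrite /fib; have lt_ii := size_iter_sigma i.
case: (leqP m i) => [le_mi|/ltnW le_im].
  by have /prefixP[s ->] := iter_sigma_prefix le_mi; rewrite nth_cat lt_i.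
by have /prefixP[s ->] := iter_sigma_prefix le_im; rewrite nth_cat lt_ii.
Qed.

Lemma pref_fib m :
  pref fib (size (iter m sigma [:: a])) = iter m sigma [:: a].
Proof.
apply: (@eq_from_nth _ a); rewrite size_mkseq // => i lt_i.
by rewrite nth_mkseq // (fibE lt_i).
Qed.

Lemma take_pref x m n : m <= n -> take m (pref x n) = pref x m.
Proof. by move=> le_mn; rewrite -map_take take_iota (minn_idPl le_mn). Qed.

Lemma fib_fixpoint : fib 0 = a /\ fixed_by_sigma fib.
Proof.
split=> // n; set s := sigma _.
have pre_s : prefix s (iter n.+1 sigma [:: a]).
  rewrite iterS -(pref_fib n).
  rewrite -(cat_take_drop n (pref fib (size _))).
  by rewrite (take_pref _ (ltnW (size_iter_sigma n))) sigma_cat prefix_prefix.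
have le_s := size_prefix pre_s.
by rewrite -(take_pref _ le_s) pref_fib; move: pre_s; rewrite prefixE => /eqP.
Qed.

Lemma fib_unique x : x 0 = a -> fixed_by_sigma x -> x =1 fib.
Proof.
move=> x0 fix_x n.
have pref_x m : pref x (size (iter m sigma [:: a])) = iter m sigma [:: a].
  elim: m => [|m IH]; first by rewrite /= /pref /mkseq /= x0.
  by rewrite iterS -[in RHS]IH fix_x IH.
by rewrite /fib -{1}(pref_x n) nth_mkseq // size_iter_sigma.
Qed.

Lemma occurs_infinitely w N : factor w -> exists2 n, N < n & occurs_at w n.
Proof.
case=> m w_m; pose k := maxn m N.
have w_k : infix w (iter k sigma [:: a]).
  apply: infix_trans w_m _; rewrite -(pref_fib k); apply: prefixW.
  rewrite prefixE size_mkseq take_pref //.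
  by rewrite ltnW // (leq_trans _ (size_iter_sigma k)) // ltnS leq_maxl.
have /infixP[u [v def_k]] := w_k.
have lt_N : N < size (iter k.+1 sigma [:: a]).
  by apply: leq_trans (size_iter_sigma k.+1); rewrite ltnS leqW ?leq_maxr.
exists (size (iter k.+1 sigma [:: a] ++ u ++ w)).
  by rewrite size_cat ltn_addr.
have pre : prefix (iter k.+1 sigma [:: a] ++ u ++ w) (iter k.+2 sigma [:: a]).
  by apply/prefixP; exists v; rewrite iter_sigmaSS -!catA -def_k.
rewrite /occurs_at -(take_pref _ (size_prefix pre)) pref_fib.
by move: pre; rewrite prefixE => /eqP ->; rewrite catA suffix_suffix.
Qed.

Lemma P_spec w p n : factor w -> 0 < p -> is_occurrence w p n <-> P w p = n.
Proof.
move=> fw p_gt0; pose c n := count (occurs_at w) (iota 1 n).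
have cS m : c m.+1 = c m + occurs_at w m.+1.
  by rewrite /c -{1}[m.+1]addn1 iotaD count_cat /= addn0 add1n.
have c_le m k : m <= k -> c m <= c k.
  move=> /subnK <-; elim: (k - m) => [//|j IH].
  by rewrite addSn cS (leq_trans IH) // leq_addr.
have c_unb q : exists m, q <= c m.
  elim: q => [|q [m le_q]]; first by exists 0.
  have [[//|k] lt_mk ok] := occurs_infinitely m fw.
  by exists k.+1; rewrite cS ok addn1 ltnS (leq_trans le_q) // c_le.
have uniq_n m k : is_occurrence w p m -> is_occurrence w p k -> m <= k.
  rewrite /is_occurrence -/(c m) -/(c k) => -[om cm] [ok ck].
  rewrite leqNgt; apply/negP; case: m om cm => [//|m] om cm.
  by rewrite ltnS => /c_le; rewrite ck -cm cS om addn1 ltnn.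
have [m om] : exists m, is_occurrence w p m.
  case: (ex_minnP (c_unb p)) => -[|m] le_p min_m.
    by move: le_p p_gt0; rewrite leqn0 => /eqP ->.
  exists m.+1; rewrite /is_occurrence -/(c m.+1).
  have lt_p : c m < p by rewrite ltnNge; apply/negP => /min_m; rewrite ltnn.
  move: le_p; rewrite cS; case: occurs_at => [|].
    by rewrite addn1 => le_p; split=> //; apply/eqP; rewrite eqn_leq lt_p.
  by rewrite addn0 leqNgt lt_p.
have oP : is_occurrence w p (P w p) by apply: (@xgetI _ _ [set n | is_occurrence w p n]%classic m).
split=> [on|<- //]; apply/eqP.
by rewrite eqn_leq !uniq_n.
Qed.

Lemma size_kernel k : k <= size (kernel k).
Proof.
case: k => [//|k]; have lt_k := size_iter_sigma k.
rewrite /kernel /= size_takel ?leq_pred //.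
by move: lt_k; case: size.
Qed.

Lemma kernel_le_Ker_index w k : infix (kernel k) w -> k <= Ker_index w.
Proof.
move=> kw; have lt_k : k < (size w).+1.
  by rewrite ltnS (leq_trans (size_kernel k)) // size_infix.
exact: (@leq_bigmax_cond _ (fun i : 'I__ => infix (kernel i) w) _ (Ordinal lt_k)).
Qed.

Lemma Ker_infix w : w <> [::] -> infix (Ker w) w.
Proof.
case: w => [//|x w] _.
have [k lt_k] : exists2 k : 'I_(size (x :: w)).+1, true & infix (kernel k) (x :: w).
  case: x; [exists ord0 | exists (Ordinal (isT : 1 < (size (b :: w)).+1))];
    by rewrite //= /infix /= ?prefix0s.
move=> kw; rewrite /Ker /Ker_index.
by rewrite (bigmax_eq_arg k kw); case: arg_maxnP.
Qed.

(* Main.v *)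
Require Import Defs.
From mathcomp Require Import all_boot all_order.
From mathcomp Require Import boolp classical_sets.

(** The only palindromic factors with kernel [a] and [b] are [a], respectively
    [b] and [aba], and the p-th [aba] ends one letter after the p-th [b].
    If n is the position of the p-th [a], then [sigma (pref fib n)] is a prefix
    of the Fibonacci sequence with n letters [a] and p letters [b], it ends in
    [b] and is followed by [a].  Hence its length is the position of the p-th
    [b], and the next position is that of the (n+1)-th [a]. *)

Lemma pref_fibS n : pref fib n.+1 = rcons (pref fib n) (fib n).
Proof. exact: mkseqS. Qed.

Lemma occurs_at_letter x n : occurs_at [:: x] n.+1 = (x == fib n).
Proof. by rewrite /occurs_at pref_fibS /suffix rev_rcons /= prefix0s andbT. Qed.

Lemma count_occurs_at_letter x n :
  count (occurs_at [:: x]) (iota 1 n) = count_mem x (pref fib n).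
Proof.
elim: n => [//|n IH].
rewrite -{1}[n.+1]addn1 iotaD count_cat IH pref_fibS -cats1 count_cat add1n /=.
by rewrite occurs_at_letter eq_sym.
Qed.

Lemma sigma_rcons w x : sigma (rcons w x) = sigma w ++ sigma_letter x.
Proof. by rewrite -cats1 sigma_cat /sigma /= cats0. Qed.

(** Each of the blocks [ab] and [a] contains exactly one [a]; a [b] comes only from the image of an
    [a]. *)
Lemma count_a_sigma w : count_mem a (sigma w) = size w.
Proof. by elim: w => [//|[] w IH]; rewrite /sigma /= -/(sigma w) IH. Qed.

Lemma count_b_sigma w : count_mem b (sigma w) = count_mem a w.
Proof. by elim: w => [//|[] w IH]; rewrite /sigma /= -/(sigma w) IH. Qed.

(** A [b] can only be the second letter of a block [ab]. The default value [a] of [nth] forces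
    position [i.+1] to lie inside the word. *)
Lemma nth_sigma_before_b w i :
  nth a (sigma w) i.+1 = b -> nth a (sigma w) i = a.
Proof.
elim: w i => [//|[] w IH] i; rewrite /sigma /= -/(sigma w).
  by case: i => [|[|i]] //=; [case: (w) => [|[]] | exact: IH].
by case: i => [|i] //=; exact: IH.
Qed.

Lemma size_sigma_geq w : size w <= size (sigma w).
Proof. by rewrite -{1}(count_a_sigma w) count_size. Qed.

Lemma fib_before_b n : fib n.+1 = b -> fib n = a.
Proof.
(* A prefix of length [n.+2] is no longer than its image, so both indices lie inside the image. *)
have [_ /(_ n.+2) fix_n] := fib_fixpoint.
have := size_sigma_geq (pref fib n.+2); rewrite size_mkseq => lt_n.
have := @nth_sigma_before_b (pref fib n.+2) n.
by rewrite fix_n !nth_mkseq // ltnW.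
Qed.

Lemma fib_after_b n : fib n = b -> fib n.+1 = a.
Proof.
by move=> fn; case E: (fib n.+1) => //; move: (fib_before_b _ E); rewrite fn.
Qed.

Lemma factor_no_bb w : factor w -> ~~ infix [:: b; b] w.
Proof.
case=> n w_n; apply/negP => bb_w.
have /infixP[u [v E]] := infix_trans bb_w w_n.
have lt_n : (size u).+1 < n.
  by rewrite -(size_mkseq fib n) -/(pref fib n) E !size_cat /= !addnS !ltnS leq_addr.
have h i : i < 2 -> fib (size u + i) = b.
  move=> lt_i; rewrite -(nth_mkseq a fib (n := n)); last first.
    by rewrite (leq_ltn_trans _ lt_n) // -addn1 leq_add2l.
  by rewrite -/(pref fib n) E nth_cat ltnNge leq_addr addKn nth_cat lt_i; case: i lt_i => [|[]].
have := h 0 isT; rewrite addn0 => /fib_after_b.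
by have := h 1 isT; rewrite addn1 => ->.
Qed.

(** The sequence starts with [a] and has no [bb], so every [b] stands between two letters [a]. *)
Lemma occurs_at_aba n : occurs_at [:: a; b; a] n.+2 = occurs_at [:: b] n.+1.
Proof.
rewrite occurs_at_letter; case: n => [//|n].
rewrite /occurs_at !pref_fibS /suffix !rev_rcons /= prefix0s andbT.
case E: (fib n.+1) => /=; first by rewrite andbF.
by rewrite (fib_after_b _ E) (fib_before_b _ E).
Qed.

Lemma count_occurs_at_aba n :
  count (occurs_at [:: a; b; a]) (iota 1 n.+1) =
  count (occurs_at [:: b]) (iota 1 n).
Proof.
elim: n => [//|n IH].
rewrite -{1}[n.+2]addn1 -{2}[n.+1]addn1 !iotaD !count_cat IH !add1n /=.
by rewrite occurs_at_aba.
Qed.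

Lemma factor_prefix w n : prefix w (pref fib n) -> factor w.
Proof. by exists n; exact: prefixW. Qed.

Lemma factor_a : factor [:: a].
Proof. exact: (@factor_prefix _ 1). Qed.

Lemma factor_b : factor [:: b].
Proof. by exists 2. Qed.

Lemma factor_aba : factor [:: a; b; a].
Proof. exact: (@factor_prefix _ 3). Qed.

Lemma sigma_pref_P_a p (n := P [:: a] p) : 0 < p ->
  pref fib (n + p) = sigma (pref fib n.-1) ++ [:: a; b] /\
  [/\ count_mem a (pref fib (n + p)) = n, count_mem b (pref fib (n + p)) = p,
      0 < n & fib (n + p) = a].
Proof.
move=> hp; have [] := (P_spec n factor_a hp).2 erefl; rewrite count_occurs_at_letter.
case: n => [//|m]; rewrite occurs_at_letter => /eqP fm cm.
have [_ fix_] := fib_fixpoint.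
(* The image has one [a] for each of the [m.+1] letters and one [b] for each of the [p] letters [a]
   among them. *)
have s_m : size (sigma (pref fib m.+1)) = m.+1 + p.
  rewrite -(count_predC (pred1 a)) count_a_sigma size_mkseq.
  rewrite (eq_count (a2 := pred1 b)); last by case.
  by rewrite count_b_sigma cm.
have Em : pref fib (m.+1 + p) = sigma (pref fib m.+1) by rewrite fix_ s_m.
rewrite Em count_a_sigma count_b_sigma size_mkseq cm; split.
  by rewrite pref_fibS sigma_rcons -fm.
split=> //; apply: fib_after_b.
(* Comparing last letters gives [fib (m + p) = b], as the image ends in the block [ab]. *)
have := pref_fibS (m + p); rewrite -addSn Em pref_fibS sigma_rcons -fm /=.
by rewrite -[[:: a; b]]/([:: a] ++ [:: b]) catA cats1 => /rcons_inj[_ <-].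
Qed.

Lemma P_b p : 0 < p -> P [:: b] p = P [:: a] p + p.
Proof.
move=> hp; have [E [_ cb n0 _]] := sigma_pref_P_a _ hp.
apply/P_spec => //; first exact: factor_b.
split; last by rewrite count_occurs_at_letter.
by rewrite /occurs_at E -[[:: a; b]]/([:: a] ++ [:: b]) catA suffix_suffix.
Qed.

Lemma P_aba p : 0 < p -> P [:: a; b; a] p = (P [:: b] p).+1.
Proof.
move=> hp; have [ob cb] := (P_spec _ factor_b hp).2 erefl.
apply/P_spec => //; first exact: factor_aba.
split; last by rewrite count_occurs_at_aba.
by case: P ob {cb} => // m; rewrite occurs_at_aba.
Qed.

Lemma P_a_P_a p : 0 < p -> P [:: a] (P [:: a] p + 1) = (P [:: b] p).+1.
Proof.
move=> hp; have [E [ca _ n0 fn]] := sigma_pref_P_a _ hp.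
rewrite (P_b _ hp) addn1; apply/P_spec => //; first exact: factor_a.
split; first by rewrite occurs_at_letter fn.
by rewrite count_occurs_at_letter pref_fibS -cats1 count_cat ca /= fn addn1.
Qed.

Lemma Ker_index_size w : Ker_index w <= size (Ker w).
Proof. exact: size_kernel. Qed.

Lemma not_infix_kernel w k : Ker_index w < k -> ~~ infix (kernel k) w.
Proof. by rewrite ltnNge; apply: contra; exact: kernel_le_Ker_index. Qed.

Lemma pal_Ker_a w : pal_factors w /\ Ker w = [:: a] <-> w = [:: a].
Proof.
split=> [[[w0 _ _] Kw]|->]; last first.
  by split; [split=> //; exact: factor_a | rewrite /Ker /Ker_index big_mkcond !big_ord_recr big_ord0].
(* Since [kernel k] has at least [k] letters, a one-letter kernel has index 0 or 1, and [kernel 1]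
   is [b]. *)
have k0 : Ker_index w = 0.
  have := Ker_index_size w; move: Kw; rewrite /Ker.
  by case: (Ker_index w) => [|[|k]] // ->.
have := @not_infix_kernel w 1; have := @not_infix_kernel w 2; rewrite k0.
move=> /(_ isT) h2 /(_ isT) h1.
rewrite -[kernel 1]/[:: b] -[kernel 2]/[:: a; a] in h1 h2.
by case: w h1 h2 {Kw k0} w0 => [|[] [|[] w]] //=; rewrite !prefix0s.
Qed.

(** Excluding [aa], [bb] and [bab] leaves only factors of [aba]; the palindromes among them that
    contain [b] are [b] and [aba]. *)
Lemma pal_Ker_b w :
  pal_factors w /\ Ker w = [:: b] <-> w = [:: b] \/ w = [:: a; b; a].
Proof.
split=> [[[w0 rw fw] Kw]|]; last first.
  case=> ->; (split; [split=> // | rewrite /Ker /Ker_index big_mkcond !big_ord_recr big_ord0 //]).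
    exact: factor_b.
  exact: factor_aba.
have k1 : Ker_index w = 1.
  have := Ker_index_size w; move: Kw; rewrite /Ker.
  by case: (Ker_index w) => [|[|k]] // ->.
have h2 : ~~ infix (kernel 2) w by rewrite not_infix_kernel ?k1.
have h3 : ~~ infix (kernel 3) w by rewrite not_infix_kernel ?k1.
rewrite -[kernel 2]/[:: a; a] -[kernel 3]/[:: b; a; b] in h2 h3.
have hb := factor_no_bb _ fw.
have ib : infix [:: b] w by rewrite -Kw Ker_infix.
(* Four letters suffice: an alternating word of length 4 already contains [bab]. *)
case: w h2 h3 hb ib rw {Kw k1 fw} w0
  => [|[] [|[] [|[] [|[] w]]]] //=; rewrite ?prefix0s ?orbT //; by [left|right].
Qed.

Theorem mainTheorem9 (p : nat) (hp : 1 <= p) :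
  exists n : nat,
    [/\ is_max (bracket (kernel 1) p) n,
        is_max (bracket [:: b] p) n
      & bracket [:: a] (P [:: a] p + 1) = [set n]%classic].
Proof.
have max_b : is_max (bracket [:: b] p) (P [:: b] p).+1.
  (* The maximum is attained by [aba]; the other palindrome, [b], ends one position earlier. *)
  split; first by exists [:: a; b; a]; [apply/pal_Ker_b; right | exact: P_aba].
  by move=> _ [w /pal_Ker_b[->|->] <-]; rewrite ?P_aba // leqnSn.
exists (P [:: b] p).+1; split=> //.
apply/seteqP; split=> [_ [w /pal_Ker_a -> <-]|_ ->]; first exact: P_a_P_a.
by exists [:: a]; [apply/pal_Ker_a | exact: P_a_P_a].
Qed.
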